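(* Let $X\subseteq2^\omega$ and let $f:2^\omega\to2^\omega$ be a continuous mapping. If $X$ is $\mathcal N$-additive, then so is $f(X)$.
   Context: $2^\omega$ is the Cantor cube with its product topology, a compact group under coordinatewise addition mod 2. $\mathcal N$ is the ideal of subsets of $2^\omega$ that are null for the Haar (= usual product) measure. A set $X\subseteq2^\omega$ is $\mathcal N$-additive if $X+N=\{x+y:x\in X,y\in N\}\in\mathcal N$ for every $N\in\mathcal N$. *)

(* Defs.v *)
From HB Require Import structures.
From mathcomp Require Import all_boot all_order all_algebra.
From mathcomp Require Import all_classical all_reals all_analysis.
Import Order.TTheory GRing.Theory Num.Theory.
Import numFieldNormedType.Exports.

Set Implicit Arguments.
Unset Strict Implicit.
Unset Printing Implicit Defensive.

Local Open Scope classical_set_scope.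
Local Open Scope ring_scope.

Definition cantor_add (x y : cantor_space) : cantor_space :=
  fun i => x i (+) y i.

(* [A] depends only on the first [n] coordinates. *)
Definition determined (n : nat) (A : set cantor_space) : Prop :=
  forall x y : cantor_space,
    (forall i, (i < n)%N -> x i = y i) -> A x -> A y.

Definition cylinder : set (set cantor_space) :=
  [set A | exists n, determined n A].

Lemma determined_widen m n A : (m <= n)%N -> determined m A -> determined n A.
Proof.
by move=> mn mA x y xy; apply: mA => i im; apply: xy; exact: leq_trans mn.
Qed.

Lemma determinedC n A : determined n A -> determined n (~` A).
Proof. by move=> nA x y xy Ax Ay; apply: Ax; apply: nA Ay => i /xy ->. Qed.

Lemma determinedU n A B : determined n A -> determined n B ->
  determined n (A `|` B).
Proof.
by move=> nA nB x y xy [/(nA _ _ xy)|/(nB _ _ xy)] ?; [left|right].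
Qed.

Lemma cylinder0 : cylinder set0.
Proof. by exists 0%N => x y. Qed.

Lemma cylinderC : setC_closed cylinder.
Proof. by move=> A [n nA]; exists n; exact: determinedC. Qed.

Lemma cylinderU : setU_closed cylinder.
Proof.
move=> A B [m mA] [n nB]; exists (maxn m n); apply: determinedU.
- by apply: determined_widen mA; exact: leq_maxl.
- by apply: determined_widen nB; exact: leq_maxr.
Qed.

Lemma determined_open n A : determined n A -> open A.
Proof.
move=> nA; rewrite openE => x Ax.
have : nbhs x [set y | forall i : 'I_n, x i = (y : cantor_space) i].
  apply: (@filter_forall cantor_space _
    (fun (i : 'I_n) => [set y : cantor_space | x i = y i]) (nbhs x)
    (nbhs_filter x)) => i.
  have /(_ x [set x i]) := @proj_continuous nat (fun=> bool) i.
  by move=> /(_ (discrete_set1 _)); apply: filterS => y /= ->.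
by apply: filterS => y xy; apply: nA Ax => i ni; exact: (xy (Ordinal ni)).
Qed.

Lemma cylinder_open A : cylinder A -> open A.
Proof. by move=> [n]; exact: determined_open. Qed.

Lemma cantor_nbhs (x : cantor_space) (U : set cantor_space) : nbhs x U ->
  exists n, [set y : cantor_space | forall i, (i < n)%N -> x i = y i] `<=` U.
Proof.
pose B n := [set y : cantor_space | forall i, (i < n)%N -> x i = y i].
pose G := filter_from [set: nat] B.
have FG : Filter G.
  apply: filter_from_filter; first by exists 0%N.
  move=> m n _ _; exists (maxn m n) => // y xy; split=> i im; apply: xy.
    exact: leq_trans (leq_maxl _ _).
  exact: leq_trans (leq_maxr _ _).
have Gx : G --> (x : cantor_space).
  apply/cvg_sup => i W [V [[N oN <-] /= Nx] NW].
  by exists i.+1 => // y xy; apply: NW; rewrite /= -xy.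
by move=> /Gx[n _ nU]; exists n.
Qed.

Lemma sigma_cylinderE : <<s cylinder >> = <<s @open cantor_space >>.
Proof.
apply/seteqP; split; apply: smallest_sub; try exact: smallest_sigma_algebra.
  by move=> A /cylinder_open oA; exact: sub_sigma_algebra.
move=> U oU; pose V n := [set x : cantor_space |
  [set y : cantor_space | forall i, (i < n)%N -> x i = y i] `<=` U].
have -> : U = \bigcup_n V n.
  apply/seteqP; split=> [x Ux|x [n _ nU]]; last exact: nU.
  have [n nU] : exists n, V n x by apply: cantor_nbhs; exact: open_nbhs_nbhs.
  by exists n.
apply: sigma_algebra_bigcup => n; apply: sub_sigma_algebra; exists n.
by move=> x y xy xU z yz; apply: xU => i ni; rewrite xy// yz.
Qed.

(* [cantor_space] with the algebra of cylinder sets as its measurable sets. *)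
Definition cylinder_type : Type := cantor_space.

Definition cylinder_display : measure_display. Proof. exact. Qed.

HB.instance Definition _ := Pointed.on cylinder_type.
HB.instance Definition _ :=
  @isAlgebraOfSets.Build cylinder_display cylinder_type
    cylinder cylinder0 cylinderU cylinderC.

Definition prefix_point n (s : n.-tuple bool) : cantor_space :=
  fun i => nth false s i.

(* The binary words of length [n] whose extension by zeros lies in [A]. *)
Definition words (n : nat) (A : set cantor_space) : {set n.-tuple bool} :=
  [set s : n.-tuple bool | `[< A (prefix_point s) >]]%SET.

Lemma wordsP n A (s : n.-tuple bool) :
  reflect (A (prefix_point s)) (s \in words n A).
Proof. by rewrite inE; exact: asboolP. Qed.

Section cylinder_measure.
Context {R : realType}.

(* Independent of [n] as soon as [determined n A]. *)
Definition cylinder_freq (n : nat) (A : set cantor_space) : R :=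
  #|words n A|%:R / 2 ^+ n.

Definition cylinder_measure (A : set cylinder_type) : \bar R :=
  (limn (cylinder_freq ^~ A))%:E.

Lemma cylinder_freqS n A : determined n A ->
  cylinder_freq n.+1 A = cylinder_freq n A.
Proof.
move=> nA; pose ext (u : n.-tuple bool * bool) := [tuple of rcons u.1 u.2].
have extI : injective ext.
  move=> [s b] [t c] /(congr1 val)/= /rcons_inj[st ->].
  by congr (_, _); exact: val_inj.
rewrite /cylinder_freq.
suff -> : words n.+1 A = [set ext u | u in finset.setX (words n A) [set: bool]]%SET.
  rewrite card_imset// cardsX cardsT card_bool natrM exprSr invfM mulrACA.
  by rewrite mulfV ?mulr1// pnatr_eq0.
have agree (s : n.-tuple bool) b i : (i < n)%N ->
    prefix_point (ext (s, b)) i = prefix_point s i.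
  by move=> ni; rewrite /prefix_point/= nth_rcons size_tuple ni.
apply/finset.setP => s; apply/wordsP/imsetP => [As|[[t b]]].
  have st : size (take n s) == n by rewrite size_take size_tuple ltnSn.
  have sE : s = ext (Tuple st, nth false s n).
    apply: val_inj => /=; rewrite -take_nth ?size_tuple// take_oversize//.
    by rewrite size_tuple.
  exists (Tuple st, nth false s n) => //.
  rewrite finset.in_setX finset.in_setT andbT; apply/wordsP.
  by apply: nA As => i ni; rewrite {1}sE agree.
rewrite finset.in_setX => /andP[/wordsP At _] ->.
by apply: nA At => i ni; rewrite agree.
Qed.

Lemma cylinder_measureE n A : determined n A ->
  cylinder_measure A = (cylinder_freq n A)%:E.
Proof.
move=> nA; congr (_%:E); apply/cvg_lim => //.
apply: cvg_near_cst; exists n => // m /=.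
elim: m => [|m IH]; first by rewrite leqn0 => /eqP ->.
rewrite leq_eqVlt => /predU1P[-> //|]; rewrite ltnS => nm.
by rewrite cylinder_freqS ?IH//; exact: determined_widen nA.
Qed.

Lemma cylinder_freq_ge0 n A : 0 <= cylinder_freq n A.
Proof. by rewrite /cylinder_freq divr_ge0// exprn_ge0. Qed.

Lemma cylinder_freq_le n A B : A `<=` B ->
  cylinder_freq n A <= cylinder_freq n B.
Proof.
move=> AB; rewrite ler_pM2r ?invr_gt0 ?exprn_gt0// ler_nat subset_leq_card//.
by apply/fintype.subsetP => s /wordsP/AB ?; exact/wordsP.
Qed.

Lemma cylinder_freq_disj n A B : A `&` B = set0 ->
  cylinder_freq n (A `|` B) = cylinder_freq n A + cylinder_freq n B.
Proof.
move=> AB; rewrite -mulrDl -natrD; congr (_%:R / _).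
have -> : words n (A `|` B) = finset.setU (words n A) (words n B).
  by apply/finset.setP => s; rewrite !inE asbool_or.
rewrite cardsU [finset.setI _ _](_ : _ = finset.set0) ?cards0 ?subn0//.
apply/finset.setP => s; rewrite !inE -asbool_and; apply/asboolP => -[As Bs].
by have : (A `&` B) (prefix_point s) by []; rewrite AB.
Qed.

Lemma cylinder_measure_ge0 A : (0 <= cylinder_measure A)%E.
Proof.
rewrite /cylinder_measure lee_fin.
have [/limr_ge|/dvgP] := pselect (cvgn (cylinder_freq ^~ A)).
  by apply; apply: nearW => n; exact: cylinder_freq_ge0.
by move=> ->.
Qed.

Lemma cylinder_measure0 : cylinder_measure set0 = 0%E.
Proof.
rewrite (@cylinder_measureE 0)//; congr (_%:E).
rewrite /cylinder_freq (_ : words _ _ = finset.set0) ?cards0 ?mul0r//.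
by apply/finset.setP => s; rewrite !inE; exact/asboolP.
Qed.

Lemma cylinder_measure_semi_additive : measure_function.semi_additive cylinder_measure.
Proof.
apply/(additive2P cylinder_measure0) => A B [m mA] [n nB] AB.
have mnA := determined_widen (leq_maxl m n) mA.
have mnB := determined_widen (leq_maxr m n) nB.
rewrite (cylinder_measureE mnA) (cylinder_measureE mnB).
by rewrite (cylinder_measureE (determinedU mnA mnB)) cylinder_freq_disj.
Qed.

HB.instance Definition _ := isContent.Build _ cylinder_type R cylinder_measure
  cylinder_measure_ge0 cylinder_measure_semi_additive.

Lemma cylinder_measure_sigma_subadditive :
  measurable_subset_sigma_subadditive cylinder_measure.
Proof.
move=> A F mF mA AF.
have [N AN] : exists N, A `<=` \big[setU/set0]_(i < N) F i.
  have := cantor_space_compact; rewrite compact_cover.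
  move=> /(_ nat setT (fun i => F i `|` ~` A)) [i _||D _ cD].
  - by apply: cylinder_open; apply: cylinderU; [exact: mF|exact: (cylinderC mA)].
  - move=> x _; have [/AF[i _ Fx]|nAx] := pselect (A x).
      by exists i => //; left.
    by exists 0%N => //; right.
  - exists (\max_(i <- finmap.enum_fset D) i).+1 => x Ax.
    have [//|i Di [Fx|//]] := cD x.
    rewrite -bigcup_mkord; exists i => //=; rewrite ltnS.
    exact: (@leq_bigmax_seq _ (finmap.enum_fset D) xpredT id).
apply: (@le_trans _ _ (\sum_(0 <= i < N) cylinder_measure (F i))%E).
  rewrite big_mkord.
  exact: (@content_subadditive _ _ _ cylinder_measure A F N).
by apply: nneseries_lim_ge => i _ _; exact: cylinder_measure_ge0.
Qed.

HB.instance Definition _ := Content_SigmaSubAdditive_isMeasure.Build _ _ _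
  cylinder_measure cylinder_measure_sigma_subadditive.

End cylinder_measure.
Arguments cylinder_measure : clear implicits.

Definition haar (R : realType) := measure_extension (cylinder_measure R).
HB.instance Definition _ (R : realType) := Measure.on (haar R).

Lemma haar_determined (R : realType) n (A : set cantor_space) :
  determined n A -> haar R A = (cylinder_freq n A)%:E.
Proof.
move=> nA; rewrite -(cylinder_measureE nA).
by apply: measurable_mu_extE; exists n.
Qed.

Lemma haar_setT (R : realType) : haar R setT = 1%E.
Proof.
rewrite (@haar_determined _ 0)//; congr (_%:E).
rewrite /cylinder_freq (_ : words _ _ = [set: 0.-tuple bool]%SET).
  by rewrite cardsT card_tuple expr0 divr1.
by apply/finset.setP => s; rewrite !inE; exact/asboolP.
Qed.

HB.instance Definition _ (R : realType) :=
  @Measure_isProbability.Build _ _ R (haar R) (haar_setT R).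

Lemma haar_basic_cylinder (R : realType) (n : nat) (x : cantor_space) :
  haar R [set y | forall i, (i < n)%N -> x i = y i] = (2 ^- n)%:E.
Proof.
rewrite (@haar_determined _ n); last first.
  by move=> y z yz xy i ni; rewrite xy// yz.
congr (_%:E); pose t : n.-tuple bool := [tuple x i | i < n].
have tE i : (i < n)%N -> prefix_point t i = x i.
  by move=> ni; rewrite -[i]/(val (Ordinal ni)) /prefix_point -tnth_nth tnth_mktuple.
rewrite /cylinder_freq (_ : words _ _ = [set t]%SET) ?cards1 ?mul1r//.
apply/finset.setP => s; rewrite finset.in_set1; apply/wordsP/eqP => [/= xs|-> i ni].
  apply: eq_from_tnth => i; rewrite tnth_mktuple xs//.
  by rewrite /prefix_point -tnth_nth.
by rewrite tE.
Qed.

Lemma cantor_addA : associative cantor_add.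
Proof. by move=> x y z; apply/funext => i; rewrite /cantor_add addbA. Qed.

Lemma cantor_addK x : involutive (cantor_add x).
Proof. by move=> y; apply/funext => i; rewrite /cantor_add addKb. Qed.

Lemma cantor_add_preimage x A : cantor_add x @` A = cantor_add x @^-1` A.
Proof.
apply/seteqP; split=> [_ [y Ay <-]|y Ay]; first by rewrite /preimage/= cantor_addK.
by exists (cantor_add x y) => //; rewrite cantor_addK.
Qed.

Lemma determined_translate x n A : determined n A ->
  determined n (cantor_add x @` A).
Proof.
rewrite cantor_add_preimage => nA y z yz; apply: nA => i ni.
by rewrite /cantor_add yz.
Qed.

Lemma cylinder_freq_translate (R : realType) x n A : determined n A ->
  cylinder_freq n (cantor_add x @` A) = cylinder_freq n A :> R.
Proof.
move=> nA; rewrite /cylinder_freq; congr (_%:R / _).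
pose h (s : n.-tuple bool) := [tuple x i (+) tnth s i | i < n].
have hK : involutive h.
  by move=> s; apply: eq_from_tnth => i; rewrite !tnth_mktuple addKb.
have hE s i : (i < n)%N -> prefix_point (h s) i = cantor_add x (prefix_point s) i.
  move=> ni; rewrite /cantor_add -[i]/(val (Ordinal ni)) /prefix_point.
  by rewrite -!tnth_nth tnth_mktuple.
rewrite -(card_imset _ (inv_inj hK)); apply: eq_card => s.
rewrite -[s in LHS]hK mem_imset; last exact: inv_inj.
rewrite cantor_add_preimage; apply/wordsP/wordsP => /= As.
  by apply: nA As => i ni; rewrite /cantor_add hE// /cantor_add addKb.
by apply: nA As => i ni; rewrite /cantor_add hE// /cantor_add addKb.
Qed.

Lemma haar_translate (R : realType) x (A : set cantor_space) :
  haar R (cantor_add x @` A) = haar R A.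
Proof.
wlog suff le : A / (haar R (cantor_add x @` A) <= haar R A)%E.
  apply/eqP; rewrite eq_le le/=.
  rewrite -[X in (haar R X <= _)%E](_ : cantor_add x @` (cantor_add x @` A) = A) ?le//.
  by rewrite !cantor_add_preimage/=; apply/seteqP; split => y;
    rewrite /preimage/= cantor_addK.
apply: le_ereal_inf_tmp => _ [F [mF AF] <-].
apply: ereal_inf_lbound; exists (fun k => cantor_add x @` F k).
  split=> [k|_ [y /AF[k _ Fy] <-]]; last by exists k => //; exists y.
  by have [n nF] := mF k; exists n; exact: determined_translate.
apply: eq_eseriesr => k _; have [n nF] := mF k.
rewrite /= (cylinder_measureE (@determined_translate x _ _ nF)).
by rewrite (cylinder_measureE nF) cylinder_freq_translate.
Qed.

Definition null_ideal (R : realType) : set (set cantor_space) :=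
  [set A | (haar R).-negligible A].

Definition null_additive (R : realType) (X : set cantor_space) : Prop :=
  forall N, null_ideal R N ->
    null_ideal R [set cantor_add x y | x in X & y in N].

(* Main.v *)
(* The proof goes through prefixes. Call [Y] thin along a sequence [d] if for
   almost all [n] the points of [Y] have at most [2^n] prefixes of length [d n].

   If [X] is null-additive, then for sequences [d] growing fast enough [X] is a
   countable union of sets thin along [d]. Read the coordinates between [d n]
   and [d n.+1] as a table giving [n] bits to each word of length [d n], and let
   [lookup (d n) n] be the set of [z] whose own prefix is given the bits 0. It
   has measure [2^-n], and translates of it by points with distinct prefixes of
   length [d n] are independent conditionally on the first [d n] coordinates. As
   [X] plus the limsup of these sets is null, some closed [T] of positive measure
   misses it, and for each [x] in [X], by a Baire category argument, a positive
   piece of [T] almost misses the translates by [x] of all but finitely many of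
   them. If the points [x] sharing a piece [S] had more than [2^n] prefixes for
   infinitely many [n], then [S] would have measure at most
   [(1 - 2^-n)^(2^n) <= 1/2] to an arbitrarily large power.

   Conversely, let [N] be null, contained in the limsup of cylinders [H n] of
   measure at most [4^-n]. By uniform continuity, the part of [f x] relevant to
   [H n] is determined by a prefix of [x] of some length [b n], so for [Y] thin
   along some [d >= b] the set [f(Y) + N] lies in the limsup of unions of at most
   [2^n] translates of [H n], which is null by Borel-Cantelli. *)

Require Import Defs.
From mathcomp Require Import all_boot all_order all_algebra.
From mathcomp Require Import all_classical all_reals all_analysis.
From mathcomp Require Import ring lra zify.
Import Order.TTheory GRing.Theory Num.Theory.
Import numFieldNormedType.Exports.

Set Implicit Arguments.
Unset Strict Implicit.
Unset Printing Implicit Defensive.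

Local Open Scope classical_set_scope.
Local Open Scope ring_scope.

(** * Haar outer measure and null sets *)

Section haar_outer.
Variable R : realType.
Local Notation mu := (haar R).
Implicit Types (A B C N : set cantor_space).

Lemma haar_ge0 A : (0 <= mu A)%E.
Proof. exact: mu_ext_ge0. Qed.

Lemma haar_le A B : A `<=` B -> (mu A <= mu B)%E.
Proof. exact: (@le_mu_ext _ cylinder_type R (cylinder_measure R)). Qed.

Lemma haar_bigcup_le (F : (set cantor_space)^nat) :
  (mu (\bigcup_n F n) <= \sum_(0 <= n <oo) mu (F n))%E.
Proof.
exact: (@mu_ext_sigma_subadditive _ cylinder_type R (cylinder_measure R)
  (@cylinder_measure_ge0 R)).
Qed.

Lemma haarU_le A B : (mu (A `|` B) <= mu A + mu B)%E.
Proof.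
exact: (@outer_measureU2 cylinder_type R (mu_ext (cylinder_measure R))).
Qed.

Lemma haar_fin_cover (I : finType) (P : pred I) (F : I -> set cantor_space) A :
  (forall x, A x -> exists2 i, P i & F i x) ->
  (mu A <= \sum_(i | P i) mu (F i))%E.
Proof.
move=> AF; apply: (@le_trans _ _ (mu (\big[setU/set0]_(i | P i) F i))).
  by apply: haar_le => x /AF[i Pi Fix]; rewrite (bigD1 i)//; left.
elim/big_rec2: _ => [|i x B _ IH]; first by rewrite measure0.
by apply: (le_trans (haarU_le _ _)); rewrite leeD2l.
Qed.

Lemma cylinder_measurable A : cylinder A ->
  measurable (A : set (g_sigma_algebraType (@measurable _ cylinder_type))).
Proof. by move=> cA; exact: sub_sigma_algebra. Qed.

(** An outer null set lies in a countable intersection of cylinder unions of measure below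
    [1/(k+1)], which is a measurable null set. *)
Lemma null_idealP N : null_ideal R N <-> mu N = 0%E.
Proof.
split=> [[B [_ B0 NB]]|N0].
  by apply/eqP; rewrite eq_le haar_ge0 andbT -B0; exact: haar_le.
have cov k : exists F : (set cylinder_type)^nat, @measurable_cover _ cylinder_type N F /\
    (\sum_(0 <= i <oo) cylinder_measure R (F i) < (k.+1%:R^-1)%:E)%E.
  have k0 : (0 < k.+1%:R^-1 :> R) by rewrite invr_gt0.
  have Nfin : mu N \is a fin_num by rewrite N0.
  have [_ [F NF <-]] := lb_ereal_inf_adherent k0 Nfin.
  rewrite -[ereal_inf _]/(mu N) N0 add0e => Fk.
  by exists F.
have {cov}[F FP] := choice cov.
have mF k i : measurable (F k i : set (g_sigma_algebraType (@measurable _ cylinder_type))).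
  by apply: cylinder_measurable; have [[cF _] _] := FP k; exact: cF.
exists (\bigcap_k \bigcup_i F k i); split.
- by apply: bigcapT_measurable => k; apply: bigcupT_measurable => i.
- apply/eqP; rewrite eq_le haar_ge0 andbT; apply/lee_addgt0Pr => e e0.
  rewrite add0e; have [k ke] : exists k, (k.+1%:R^-1 < e).
    have [k _ /(_ k (leqnn k)) ke] := near_infty_natSinv_lt (PosNum e0).
    by exists k.
  apply: (@le_trans _ _ (mu (\bigcup_i F k i))).
    by apply: haar_le; exact: bigcap_inf.
  apply: (@le_trans _ _ (k.+1%:R^-1)%:E); last by rewrite lee_fin ltW.
  apply: le_trans (ltW (FP k).2); apply: ereal_inf_lbound.
  by exists (F k) => //; split=> // i; have [[cF _] _] := FP k; exact: cF.
- by move=> x Nx k _; have [[_ NF] _] := FP k; exact: NF.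
Qed.

Lemma null_cover N (e : R) : null_ideal R N -> 0 < e ->
  exists F : (set cantor_space)^nat,
    [/\ forall i, cylinder (F i), N `<=` \bigcup_i F i
      & (mu (\bigcup_i F i) <= e%:E)%E].
Proof.
move=> /null_idealP N0 e0.
have Nfin : mu N \is a fin_num by rewrite N0.
have [_ [F [cF NF] <-]] := lb_ereal_inf_adherent e0 Nfin.
rewrite -[ereal_inf _]/(mu N) N0 add0e => Fe.
exists F; split; [exact: cF|exact: NF|].
by apply: le_trans (ltW Fe); apply: ereal_inf_lbound; exists F => //; split.
Qed.

(** Borel-Cantelli: the measures sum to at most 2. *)
Lemma limsup_null (F : (set cantor_space)^nat) :
  (forall n, cylinder (F n)) -> (forall n, (mu (F n) <= (2 ^- n)%:E)%E) ->
  null_ideal R (lim_sup_set F).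
Proof.
move=> cF F2; apply/null_idealP.
apply: (@lim_sup_set_cvg0 _ _ R (haar R)) => [k|]; first exact: cylinder_measurable.
apply: le_lt_trans (ltry 2); have := @epsilon_trick0 R 2 xpredT (ler0n _ 2).
apply: le_trans; apply: lee_nneseries => [n _ _|n _]; first exact: haar_ge0.
by apply: le_trans (F2 n) _; rewrite lee_fin natrX exprS invfM mulrA divff ?mul1r// pnatr_eq0.
Qed.

Lemma cylinder_fin A : cylinder A -> exists r : R, mu A = r%:E.
Proof. by move=> [n nA]; exists (cylinder_freq n A); exact: haar_determined. Qed.

Lemma haar_bigcup0 (F : (set cantor_space)^nat) :
  (forall n, mu (F n) = 0%E) -> mu (\bigcup_n F n) = 0%E.
Proof.
move=> F0; apply/eqP; rewrite eq_le haar_ge0 andbT.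
by apply: le_trans (haar_bigcup_le _) _; rewrite eseries0.
Qed.

Lemma haar_fin_cover0 (I : finType) (P : pred I) (F : I -> set cantor_space) A :
  (forall x, A x -> exists2 i, P i & F i x) ->
  (forall i, P i -> mu (F i) = 0%E) -> mu A = 0%E.
Proof.
move=> AF F0; apply/eqP; rewrite eq_le haar_ge0 andbT.
by apply: le_trans (haar_fin_cover AF) _; rewrite big1.
Qed.

Lemma haar_le0 A B : A `<=` B -> mu B = 0%E -> mu A = 0%E.
Proof. by move=> AB B0; apply/eqP; rewrite eq_le haar_ge0 -B0 haar_le. Qed.

End haar_outer.

(** * Prefixes, cylinders and coordinate flips *)

Section basic_cylinders.
Implicit Types (x y z : cantor_space) (A B C D : set cantor_space).

Definition cyl x n : set cantor_space := [set y | forall i, (i < n)%N -> x i = y i].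

Lemma determined_cyl x n : determined n (cyl x n).
Proof. by move=> y z yz xy i ni; rewrite xy// yz. Qed.

Definition prefix n x : n.-tuple bool := [tuple x i | i < n].

Lemma nth_prefix n x i : (i < n)%N -> nth false (prefix n x) i = x i.
Proof. by move=> ni; rewrite -[i]/(val (Ordinal ni)) -tnth_nth tnth_mktuple. Qed.

Lemma prefixP n x y : (forall i, (i < n)%N -> x i = y i) <-> prefix n x = prefix n y.
Proof.
split=> [xy|xy i ni]; last by rewrite -(nth_prefix x ni) xy nth_prefix.
by apply: eq_from_tnth => i; rewrite !tnth_mktuple xy.
Qed.

Lemma determinedI n A B : determined n A -> determined n B -> determined n (A `&` B).
Proof. by move=> nA nB x y xy [/(nA _ _ xy) ? /(nB _ _ xy)]. Qed.

Lemma cylinderI A B : cylinder A -> cylinder B -> cylinder (A `&` B).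
Proof.
by move=> cA cB; rewrite -[A]setCK -[B]setCK -setCU; apply/cylinderC/cylinderU;
  exact: cylinderC.
Qed.

Lemma cylinder_agree (ps : seq nat) (w : cantor_space) :
  cylinder [set z | forall p, p \in ps -> z p = w p].
Proof.
exists (\max_(p <- ps) p).+1 => x y xy xw p pps; rewrite -xw// xy//.
by rewrite ltnS (@leq_bigmax_seq _ ps xpredT id).
Qed.

Lemma cyl_agree x y n : cyl x n y -> cyl x n = cyl y n.
Proof.
by move=> xy; apply/seteqP; split=> z zn i im; rewrite -zn// xy.
Qed.

Lemma cyl_sub x n m : (n <= m)%N -> cyl x m `<=` cyl x n.
Proof. by move=> nm y xy i im; apply: xy; exact: leq_trans nm. Qed.

Lemma determined_cyl_sub A n m x : determined n A -> (n <= m)%N -> A x ->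
  cyl x m `<=` A.
Proof. by move=> nA nm Ax y xy; apply: nA Ax => i im; apply: xy; exact: leq_trans nm. Qed.

Definition flip p : cantor_space -> cantor_space := cantor_add (fun i => i == p).

Lemma flipE p z i : flip p z i = (i == p) (+) z i.
Proof. by []. Qed.

(** Independence of coordinate [p]; one implication suffices because [flip p] is an involution. *)
Definition flip_invariant p A := forall z, A z -> A (flip p z).

End basic_cylinders.

(** * Independence of disjoint blocks of coordinates *)

Section blocks.
Variable R : realType.
Local Notation mu := (haar R).
Implicit Types (A B C D : set cantor_space).

(** The flip at [p] is a translation exchanging the two halves of [A], so they have equal
    measure. *)
Lemma haar_half A p b (r : R) : cylinder A -> flip_invariant p A ->
  mu A = r%:E -> mu (A `&` [set z | z p = b]) = (r / 2)%:E.
Proof.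
move=> cA pA Ar; set C := [set z | z p = b].
have cC : cylinder C by exists p.+1 => x y xy; rewrite /C/= xy.
have mA := cylinder_measurable cA; have mC := cylinder_measurable cC.
have nb (u v : bool) : u <> v -> ~~ u = v by case: u v => [] [].
have ADC : A `\` C = flip p @` (A `&` C).
  rewrite [RHS]cantor_add_preimage; apply/seteqP; split=> z /=.
    by move=> [Az zb]; split; [exact: pA|by rewrite /C/= /cantor_add eqxx/=; exact: nb].
  move=> [/pA]; rewrite {1}/flip cantor_addK => Az; rewrite /C/= /cantor_add eqxx/= => <-.
  by split=> //; case: (z p).
have [s ACs] := cylinder_fin R (cylinderI cA cC).
have := measureDI (haar R) mA mC.
rewrite -[LHS]/(mu A) Ar -[X in (X + _)%E]/(mu (A `\` C)).
rewrite -[X in (_ + X)%E]/(mu (A `&` C)) ADC [mu (flip p @` _)]haar_translate ACs.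
rewrite -EFinD => -[->]; congr (_%:E); by field.
Qed.

Lemma haar_agree A (ps : seq nat) (w : cantor_space) (r : R) :
  cylinder A -> uniq ps -> (forall p, p \in ps -> flip_invariant p A) ->
  mu A = r%:E ->
  mu (A `&` [set z | forall p, p \in ps -> z p = w p]) = (r * 2 ^- size ps)%:E.
Proof.
elim: ps A r => [|p ps IH] A r cA /=.
  by move=> _ _ Ar; rewrite expr0 invr1 mulr1 -Ar; congr (mu _);
    apply/seteqP; split=> z // [].
move=> /andP[pps ups] inv Ar.
have -> : A `&` [set z : cantor_space | forall q, q \in p :: ps -> z q = w q] =
    (A `&` [set z | z p = w p]) `&` [set z | forall q, q \in ps -> z q = w q].
  apply/seteqP; split=> z /=.
    move=> [Az zw]; split; first by split=> //; apply: zw; rewrite mem_head.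
    by move=> q qps; apply: zw; rewrite inE qps orbT.
  move=> [[Az zp] zw]; split=> // q; rewrite inE => /predU1P[->//|]; exact: zw.
rewrite (IH _ (r / 2))//.
- by rewrite exprS invfM mulrA.
- apply: cylinderI => //; exists p.+1 => x y xy /=; by rewrite xy.
- move=> q qps z [Az zp]; split; first by apply: inv => //; rewrite inE qps orbT.
  rewrite /= flipE; case: eqVneq => // pq; by rewrite pq qps in pps.
- by apply: haar_half => //; apply: inv; rewrite mem_head.
Qed.

(** The blocks are disjoint, so what remains after deleting one cylinder is still invariant under
    flips in the other blocks, and each deletion keeps the fraction [1 - 2^-n]. *)
Lemma haar_disagree n A (I : eqType) (s : seq I) (b : I -> seq nat)
    (w : I -> cantor_space) (r : R) :
  cylinder A -> uniq (flatten (map b s)) ->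
  (forall i, i \in s -> size (b i) = n) ->
  (forall p, p \in flatten (map b s) -> flip_invariant p A) ->
  mu A = r%:E ->
  mu (A `&` [set z | forall i, i \in s -> ~ forall p, p \in b i -> z p = w i p])
  = (r * (1 - 2 ^- n) ^+ size s)%:E.
Proof.
elim: s A r => [|i s IH] A r cA /=.
  move=> _ _ _ Ar; rewrite expr0 mulr1 -Ar; congr (mu _).
  by apply/seteqP; split=> [z []//|z Az]; split.
rewrite cat_uniq => /and3P[ups /hasPn dis us] sz inv Ar.
pose C : set cantor_space := [set z | forall p, p \in b i -> z p = w i p].
have cC : cylinder C by exact: cylinder_agree.
have cAC : cylinder (A `\` C) by apply: cylinderI => //; exact: cylinderC.
have mA := cylinder_measurable cA; have mC := cylinder_measurable cC.
have AC : mu (A `\` C) = (r * (1 - 2 ^- n))%:E.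
  have [q ACq] := cylinder_fin R cAC; rewrite ACq; congr (_%:E).
  have := measureDI (haar R) mA mC.
  rewrite -[LHS]/(mu A) Ar -[X in (X + _)%E]/(mu (A `\` C)).
  rewrite -[X in (_ + X)%E]/(mu (A `&` C)) ACq (haar_agree (w i) cA ups _ Ar); last first.
    by move=> p pps; apply: inv; rewrite mem_cat pps.
  by rewrite (sz i) ?mem_head// -EFinD => -[E]; rewrite mulrBr mulr1 {1}E addrK.
set D := [set z : cantor_space | forall j, j \in s -> ~ forall p, p \in b j -> z p = w j p].
have -> : A `&` [set z : cantor_space | forall j, j \in i :: s ->
    ~ forall p, p \in b j -> z p = w j p] = (A `\` C) `&` D.
  apply/seteqP; split=> z /=.
    move=> [Az zw]; split; first by split=> //; apply: zw; rewrite mem_head.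
    by move=> j js; apply: zw; rewrite inE js orbT.
  by move=> [[Az zp] zw]; split=> // j; rewrite inE => /predU1P[->//|]; exact: zw.
rewrite (IH _ _ cAC _ _ _ AC)//.
- by rewrite exprS mulrA.
- by move=> j js; apply: sz; rewrite inE js orbT.
- move=> p pB z [Az Cz]; split; first by apply: inv => //; rewrite mem_cat pB orbT.
  move=> Cpz; apply: Cz => q qps; rewrite -Cpz// flipE.
  case: eqVneq => // qp; by have := dis _ pB; rewrite /= -qp qps.
Qed.

(** Cylinders of length [n] have measure [2^-n], so the hypothesis bounds a conditional probability
    by [c]; it is summed over the words of [A]. *)
Lemma haar_conditional_le n A D (c a : R) : determined n A ->
  (forall x, (mu (D `&` cyl x n) <= (c * 2 ^- n)%:E)%E) -> 0 <= c ->
  (mu A <= a%:E)%E -> (mu (D `&` A) <= (c * a)%:E)%E.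
Proof.
move=> nA Dc c0 Aa.
apply: (@le_trans _ _ (\sum_(s in words n A) mu (D `&` cyl (prefix_point s) n))%E).
  apply: haar_fin_cover => x [Dx Ax].
  have agree i : (i < n)%N -> prefix_point (prefix n x) i = x i.
    by move=> ni; rewrite /prefix_point nth_prefix.
  exists (prefix n x); last by split=> // i ni; rewrite agree.
  by apply/wordsP; apply: nA Ax => i ni; rewrite agree.
apply: (@le_trans _ _ (\sum_(s in words n A) (c * 2 ^- n)%:E)%E).
  by apply: lee_sum => s _; exact: Dc.
rewrite sumEFin lee_fin sumr_const -[_ *+ #|_|]mulr_natr -mulrA ler_wpM2l//.
by move: Aa; rewrite (haar_determined R nA) lee_fin mulrC.
Qed.

End blocks.

(** * Lookup tables *)

Section lookup.
Variable R : realType.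
Local Notation mu := (haar R).
Implicit Types (x y z : cantor_space) (A B C D : set cantor_space).

(** Numbering words by [enum_rank] gives distinct words disjoint intervals, all past the first [d]
    coordinates. *)
Definition block d n (t : d.-tuple bool) : seq nat := iota (d + enum_rank t * n)%N n.

Definition lookup d n : set cantor_space :=
  [set z | forall p, p \in block n (prefix d z) -> z p = false].

Definition lookup_end d n := (d + 2 ^ d * n)%N.

Lemma block_bounds d n (t : d.-tuple bool) p : p \in block n t ->
  (d <= p < lookup_end d n)%N.
Proof.
rewrite mem_iota => /andP[p1 p2]; rewrite (leq_trans (leq_addr _ _) p1)/=.
apply: (leq_trans p2); rewrite -addnA leq_add2l -mulSnr leq_mul2r.
by rewrite -[X in (_ < X ^ _)%N]card_bool -card_tuple ltn_ord orbT.
Qed.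

Lemma block_inj d n (t u : d.-tuple bool) p :
  p \in block n t -> p \in block n u -> t = u.
Proof.
have E (v : d.-tuple bool) : p \in block n v -> (enum_rank v : nat) = ((p - d) %/ n)%N.
  rewrite mem_iota => /andP[p1 p2].
  have n0 : (0 < n)%N by lia.
  have -> : (p - d = enum_rank v * n + (p - (d + enum_rank v * n)))%N by lia.
  by rewrite divnMDl// divn_small ?addn0//; lia.
by move=> /E tE /E uE; apply: enum_rank_inj; apply: val_inj; rewrite /= tE uE.
Qed.

Lemma uniq_blocks d n (s : seq (d.-tuple bool)) : uniq s ->
  uniq (flatten (map (@block d n) s)).
Proof.
elim: s => //= t s IH /andP[ts us]; rewrite cat_uniq iota_uniq IH// andbT /=.
apply/hasPn => p /flatten_mapP[u su pu]; apply/negP => /= pt.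
by move: ts; rewrite (block_inj pt pu) su.
Qed.

Lemma determined_lookup d n : determined (lookup_end d n) (lookup d n).
Proof.
move=> x y xy xl p; have <- : prefix d x = prefix d y.
  by apply/prefixP => i di; apply: xy; rewrite (leq_trans di)// leq_addr.
by move=> pb; rewrite -xy ?xl//; have /andP[] := block_bounds pb.
Qed.

Lemma determined_lookup_translate d n x :
  determined (lookup_end d n) [set z | lookup d n (cantor_add x z)].
Proof.
move=> y z yz; apply: determined_lookup => i id; by rewrite /cantor_add yz.
Qed.

Lemma cyl_flip_invariant x d p : (d <= p)%N -> flip_invariant p (cyl x d).
Proof.
move=> dp z xz i id; rewrite flipE xz//; case: eqVneq => // ip.
by move: id; rewrite ip ltnNge dp.
Qed.

(** On [cyl x d] the word looked up by [rep t + z] does not depend on [z], and distinct [t] in [W]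
    give distinct words. Avoidance thus means disagreeing with each [rep t] on its own block, and
    these blocks are disjoint. *)
Lemma haar_avoid_lookup d n (W : {set d.-tuple bool})
    (rep : d.-tuple bool -> cantor_space) x :
  (forall t, t \in W -> prefix d (rep t) = t) ->
  mu ([set z | forall t, t \in W -> ~ lookup d n (cantor_add (rep t) z)] `&` cyl x d)
  = ((1 - 2 ^- n) ^+ #|W| * 2 ^- d)%:E.
Proof.
move=> repP; pose u t := prefix d (cantor_add (rep t) x).
have uE t z : cyl x d z -> prefix d (cantor_add (rep t) z) = u t.
  by move=> xz; apply/prefixP => i di; rewrite /cantor_add xz.
have uI : {in W &, injective u}.
  move=> s t sW tW /prefixP st; rewrite -(repP s)// -(repP t)//.
  by apply/prefixP => i /st; rewrite /cantor_add => /addIb.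
have := @haar_disagree R n (cyl x d) _ (enum W) (fun t => block n (u t)) rep _
  (ex_intro _ d (@determined_cyl x d)) _ _ _ (haar_basic_cylinder R d x).
rewrite -cardE mulrC [in (_ * _)%:E]mulrC => <-.
- congr (mu _); apply/seteqP; split=> z /=.
    move=> [zW xz]; split=> // t; rewrite mem_enum => tW zt; apply: (zW _ tW) => p.
    by rewrite uE// => /zt; rewrite /cantor_add => ->; rewrite addbb.
  move=> [xz zW]; split=> // t tW zt; apply: (zW t); first by rewrite mem_enum.
  move=> p pt; have := zt p; rewrite uE// => /(_ pt); rewrite /cantor_add.
  by case: (rep t p) (z p) => [] [].
- rewrite (map_comp (@block d n) u); apply: uniq_blocks.
  by rewrite map_inj_in_uniq ?enum_uniq// => s t; rewrite !mem_enum; exact: uI.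
- by move=> t _; rewrite size_iota.
- move=> p /flatten_mapP[t _ /block_bounds/andP[dp _]]; exact: cyl_flip_invariant.
Qed.

Lemma haar_lookup d n : (mu (lookup d n) <= (2 ^- n)%:E)%E.
Proof.
rewrite -[lookup d n]setIT -[2 ^- n]mulr1.
apply: (@haar_conditional_le R d setT) => // [x|]; last first.
  by rewrite [mu setT]haar_setT.
have := @haar_agree R (cyl x d) (block n (prefix d x)) (fun=> false) _
  (ex_intro _ d (@determined_cyl x d)) (iota_uniq _ _) _ (haar_basic_cylinder R d x).
rewrite size_iota mulrC => <-.
- apply: haar_le => z [zl xz]; split=> // p pb; apply: zl.
  by move/prefixP: xz => <-.
- by move=> p /block_bounds/andP[dp _]; exact: cyl_flip_invariant.
Qed.

End lookup.

(** * Pieces of positive measure force few prefixes *)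

Section small_prefixes.
Variable R : realType.
Local Notation mu := (haar R).
Implicit Types (x y z : cantor_space) (A B C D T : set cantor_space).

(* A Baire category argument: otherwise nested cylinders would shrink to a point
   of [T] lying in infinitely many [A n]. *)
Lemma positive_cylinder_missing (F A : (set cantor_space)^nat) :
  let T := ~` \bigcup_i F i in
  (forall i, cylinder (F i)) -> (forall n, cylinder (A n)) ->
  mu T <> 0%E -> T `&` lim_sup_set A = set0 ->
  exists (s : seq bool) m, let S := T `&` cyl (nth false s) (size s) in
    mu S <> 0%E /\ forall n, (m <= n)%N -> mu (S `&` A n) = 0%E.
Proof.
move=> T cF cA T0 TA; apply: contrapT => noS.
have step (kp : nat * (cantor_space * nat)) : exists q : cantor_space * nat,
    mu (T `&` cyl kp.2.1 kp.2.2) <> 0%E ->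
    [/\ mu (T `&` cyl q.1 q.2) <> 0%E, (kp.1 < q.2)%N,
      cyl q.1 q.2 `<=` cyl kp.2.1 kp.2.2 &
      exists2 n, (kp.1 <= n)%N & cyl q.1 q.2 `<=` A n].
  case: kp => k [y l] /=; have [S0|] := pselect (mu (T `&` cyl y l) <> 0%E); last first.
    by exists (y, l).
  (* Otherwise the current piece, with [m = k], would contradict [noS]. *)
  have [n kn An] : exists2 n, (k <= n)%N & mu (T `&` cyl y l `&` A n) <> 0%E.
    apply: contrapT => noA; apply: noS; exists (prefix l y), k.
    rewrite size_tuple (_ : cyl _ l = cyl y l); last first.
      by apply: cyl_agree => i il; rewrite nth_prefix.
    split=> // n kn; apply: contrapT => An; apply: noA; by exists n.
  (* This length refines the old cylinder, decides [A n], and exceeds the stage [k]. *)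
  have [e eA] := cA n; pose l' := maxn (maxn l e) k.+1.
  have [[s Ss]|noSs] := pselect (exists s : l'.-tuple bool,
      mu (T `&` cyl y l `&` A n `&` cyl (prefix_point s) l') <> 0%E); last first.
    case: An; apply: (@haar_fin_cover0 R (l'.-tuple bool) xpredT
      (fun s => T `&` cyl y l `&` A n `&` cyl (prefix_point s) l')).
      move=> x Sx; exists (prefix l' x) => //; split=> // i il.
      by rewrite /prefix_point nth_prefix.
    by move=> s _; apply: contrapT => Ss; apply: noSs; exists s.
  have [w [[[Tw yw] Aw] sw]] : (T `&` cyl y l `&` A n `&` cyl (prefix_point s) l') !=set0.
    by apply/set0P/eqP => S00; apply: Ss; rewrite S00 measure0.
  exists (prefix_point s, l') => _ /=; rewrite (cyl_agree sw) in Ss *; split.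
  - by move=> w0; apply: Ss; apply: haar_le0 w0 => z [[[]]].
  - by rewrite leq_max ltnSn orbT.
  - rewrite (cyl_agree yw); apply: cyl_sub.
    by rewrite !leq_max leqnn.
  - exists n => //; apply: (determined_cyl_sub eA) => //.
    by rewrite !leq_max leqnn orbT.
have {step}[next nextP] := choice step.
pose P := fix P k := if k is k'.+1 then next (k', P k') else ((fun=> false) : cantor_space, 0%N).
have PT k : mu (T `&` cyl (P k).1 (P k).2) <> 0%E.
  elim: k => [|k IH] /=; last by have [] := nextP (k, P k) IH.
  by rewrite (_ : cyl _ _ = setT) ?setIT//; apply/seteqP; split=> // z _ i.
have PS k := nextP (k, P k) (PT k).
have Pl k : (k <= (P k).2)%N by case: k => // k; have [] := PS k.
have Psub j k : (j <= k)%N -> cyl (P k).1 (P k).2 `<=` cyl (P j).1 (P j).2.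
  elim: k => [|k IH]; first by rewrite leqn0 => /eqP ->.
  rewrite leq_eqVlt => /predU1P[->//|/IH]; apply: subset_trans.
  by have [] := PS k.
(* The nested cylinders shrink to this point: stage [i.+1] already fixes coordinate [i]. *)
pose z : cantor_space := fun i => (P i.+1).1 i.
have zP k : cyl (P k).1 (P k).2 z.
  move=> i ik; rewrite /z; have [ki|ik'] := leqP k i.+1.
    by apply: (Psub _ _ ki).
  by apply/esym/(Psub _ _ (ltnW ik')) => //; exact: (Pl i.+1).
suff : (T `&` lim_sup_set A) z by rewrite TA.
(* If [z] were in [F i], a late cylinder around [z] would lie inside [F i] and miss [T]. *)
split=> [[i _ Fz]|k _].
  have [q qF] := cF i; apply: (PT q).
  rewrite (_ : _ `&` _ = set0) ?measure0//; apply/seteqP; split=> // y [Ty].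
  by rewrite (cyl_agree (zP q)) => /(determined_cyl_sub qF (Pl q) Fz) Fy; apply: Ty; exists i.
by have [_ _ _ [n kn nA]] := PS k; exists n => //; apply: nA; exact: (zP k.+1).
Qed.

Definition prefixes n A : {set n.-tuple bool} :=
  [set t : n.-tuple bool | `[< exists2 x, A x & prefix n x = t >]]%SET.

(** With [q = 2^-n], Bernoulli gives [(1 + q)^k >= 2], while [(1 - q)^k (1 + q)^k <= 1]. *)
Lemma expr_halves n k : (2 ^ n <= k)%N -> (1 - 2 ^- n : R) ^+ k <= 2^-1.
Proof.
move=> nk; set q : R := 2 ^- n.
have q0 : 0 < q by rewrite invr_gt0 exprn_gt0.
have q1 : q <= 1 by rewrite invf_le1 ?exprn_gt0// exprn_ege1// ler1n.
have bernoulli m : 1 + q * m%:R <= (1 + q) ^+ m.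
  elim: m => [|m IH]; first by rewrite mulr0 addr0 expr0.
  rewrite exprS; apply: (@le_trans _ _ ((1 + q) * (1 + q * m%:R))).
    rewrite -natr1; have : 0 <= q * m%:R by rewrite mulr_ge0// ltW.
    nra.
  by rewrite ler_wpM2l// addr_ge0// ltW.
have := bernoulli k => bk.
have k2 : 1 <= q * k%:R.
  by rewrite ler_pdivlMl ?exprn_gt0// mulr1 -natrX ler_nat.
have p2 : 2 <= (1 + q) ^+ k by apply: le_trans bk; lra.
have : (1 - q) ^+ k * (1 + q) ^+ k <= 1.
  by rewrite -exprMn exprn_ile1//; nra.
have : 0 <= (1 - q) ^+ k by rewrite exprn_ge0// subr_ge0.
move: ((1 - q) ^+ k) ((1 + q) ^+ k) p2 => u v; nra.
Qed.

(** One representative per prefix gives finitely many translates at each level, so up to a null set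
    [C] avoids them all from level [m] on. Each level with more than [2^n] prefixes at least halves
    the measure left, so infinitely many of them would make [C] null. *)
Lemma prefixes_small (d : nat -> nat) X C m :
  (forall n, (lookup_end (d n) n <= d n.+1)%N) -> mu C <> 0%E ->
  (forall x, X x -> forall n, (m <= n)%N ->
     mu (C `&` [set z | lookup (d n) n (cantor_add x z)]) = 0%E) ->
  exists n0, forall n, (n0 <= n)%N -> (#|prefixes (d n) X| <= 2 ^ n)%N.
Proof.
move=> dS C0 XC; apply: contrapT => unbounded.
have dmono : {homo d : n k / (n <= k)%N >-> (n <= k)%N}.
  apply: homo_leq => [//|j i k|n]; first exact: leq_trans.
  by apply: leq_trans (dS n); exact: leq_addr.
have often k : exists2 n, (k <= n)%N & (2 ^ n < #|prefixes (d n) X|)%N.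
  apply: contrapT => no; apply: unbounded; exists k => n kn.
  by rewrite leqNgt; apply/negP => nX; apply: no; exists n.
have reps n (t : (d n).-tuple bool) : exists x,
    t \in prefixes (d n) X -> X x /\ prefix (d n) x = t.
  have [|tX] := boolP (t \in prefixes (d n) X); last by exists (fun=> false).
  by rewrite inE => /asboolP[x Xx <-]; exists x.
pose rep n := projT1 (choice (reps n)).
have repX n t (tX : t \in prefixes (d n) X) := (projT2 (choice (reps n)) t tX).1.
have repK n t (tX : t \in prefixes (d n) X) := (projT2 (choice (reps n)) t tX).2.
pose D n : set cantor_space := [set z | forall t, t \in prefixes (d n) X ->
  ~ lookup (d n) n (cantor_add (rep n t) z)].
have dD n : determined (d n.+1) (D n).
  move=> y z yz Dy t tX Lz; apply: (Dy t tX).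
  apply: (determined_widen (dS n) (@determined_lookup_translate _ _ _)) Lz => i id.
  by rewrite yz.
(* [E] is an intersection of [j] sets [D n] at crowded levels. The next level is [n >= N], so [E] is
   determined before the table of that level begins. *)
have shrink j : exists N E, [/\ determined (d N) E, (mu E <= (2 ^- j)%:E)%E &
    forall z, (forall n, (m <= n)%N -> D n z) -> E z].
  elim: j => [|j [N [E [NE Ej DE]]]].
    by exists 0%N, setT; split=> //; rewrite expr0 invr1 [mu setT]haar_setT.
  have [n Nn nX] := often (maxn N m); rewrite geq_max in Nn; case/andP: Nn => Nn mn.
  have nE := determined_widen (dmono _ _ Nn) NE.
  exists n.+1, (D n `&` E); split.
  - by apply: determinedI => //; exact: determined_widen (dmono _ _ (leqnSn n)) nE.
  - rewrite exprS invfM; apply: (haar_conditional_le nE) => // x.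
    rewrite haar_avoid_lookup ?lee_fin; last exact: repK.
    by rewrite ler_pM2r ?invr_gt0 ?exprn_gt0// expr_halves// ltnW.
  - by move=> z Dz; split; [exact: Dz|exact: DE].
(* The second set collects the points of [C] outside some [D n]; it is null by [XC]. *)
apply: C0; apply: (@haar_le0 R _ ([set z | forall n, (m <= n)%N -> D n z] `|`
    \bigcup_n [set z | C z /\ (m <= n)%N /\ ~ D n z])).
  move=> z Cz; have [|] := pselect (forall n, (m <= n)%N -> D n z); first by left.
  by move=> /existsNP[n] /not_implyP[mn Dz]; right; exists n.
apply/eqP; rewrite eq_le haar_ge0 andbT; apply: le_trans (haarU_le _ _ _) _.
rewrite [X in (_ + X)%E]haar_bigcup0 ?adde0; last first.
  move=> n; have [mn|nm] := leqP m n; last first.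
    rewrite (_ : [set _ | _] = set0) ?measure0//; apply/seteqP; split=> // z [_ []//].
  apply: (@haar_fin_cover0 R ((d n).-tuple bool) (mem (prefixes (d n) X))
    (fun t => C `&` [set z | lookup (d n) n (cantor_add (rep n t) z)])).
    move=> z [Cz [_ /existsNP[t]]] /not_implyP[tX /contrapT Lz].
    by exists t.
  by move=> t tX; apply: XC => //; exact: repX.
apply/lee_addgt0Pr => e e0; rewrite add0e.
have [j je] : exists j, 2 ^- j < e.
  have [j _ /(_ j (leqnn j)) je] := near_infty_natSinv_expn_lt (PosNum e0).
  by exists j; rewrite /= div1r in je.
have [N [E [_ Ej DE]]] := shrink j.
apply: le_trans (haar_le _ DE) _; apply: le_trans Ej _; by rewrite lee_fin ltW.
Qed.

End small_prefixes.

(** * Thin pieces of null-additive sets, and null sets inside a limsup of cylinders *)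

Section null_additive_prefixes.
Variable R : realType.
Local Notation mu := (haar R).
Implicit Types (x y z : cantor_space) (A B C N T X : set cantor_space).

Lemma null_additive_prefixes X (b : nat -> nat) : null_additive R X ->
  exists (d : nat -> nat) (Y : (set cantor_space)^nat),
    [/\ forall n, (b n <= d n)%N, X `<=` \bigcup_k Y k &
      forall k, exists n0, forall n, (n0 <= n)%N -> (#|prefixes (d n) (Y k)| <= 2 ^ n)%N].
Proof.
move=> addX.
(* Each table starts after the previous one ends; the maximum also secures [b n <= d n]. *)
pose d := fix d n := if n is m.+1 then maxn (b n) (lookup_end (d m) m) else b 0%N.
have bd n : (b n <= d n)%N by case: n => //= n; exact: leq_maxl.
have dS n : (lookup_end (d n) n <= d n.+1)%N by exact: leq_maxr.
pose L n := lookup (d n) n.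
have LN : null_ideal R (lim_sup_set L).
  apply: limsup_null => n; last exact: haar_lookup.
  by exists (lookup_end (d n) n); exact: determined_lookup.
(* Any bound below 1 leaves the complement [T] positive measure; here it is 1/2. *)
have [F [cF XLF F2]] := null_cover (addX _ LN) (divr_gt0 ltr01 (ltr0n R 2)).
pose T := ~` \bigcup_i F i.
have T0 : mu T <> 0%E.
  move=> T0; have : (mu setT <= mu (\bigcup_i F i) + mu T)%E.
    by apply: le_trans (haarU_le _ _ _); apply: haar_le; rewrite setUv.
  rewrite T0 adde0 [mu setT]haar_setT => /le_trans/(_ F2).
  by rewrite lee_fin; lra.
pose A x n : set cantor_space := [set z | lookup (d n) n (cantor_add x z)].
pose S (s : seq bool) := T `&` cyl (nth false s) (size s).
(* There are countably many codes [c]. Positivity is part of [Z], so a code of a null piece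
   contributes the empty set. *)
pose Z (c : seq bool * nat) : set cantor_space :=
  [set x | mu (S c.1) <> 0%E /\ forall n, (c.2 <= n)%N -> mu (S c.1 `&` A x n) = 0%E].
exists d, (fun k => if unpickle k is Some c then Z c else set0); split=> // [x Xx|k].
  have cA n : cylinder (A x n).
    by exists (lookup_end (d n) n); exact: determined_lookup_translate.
  (* As [z = x + (x + z)], a common point would lie in [X + lim_sup_set L], which [T] misses. *)
  have TA : T `&` lim_sup_set (A x) = set0.
    apply/seteqP; split=> // z [Tz Az]; apply: Tz; apply: XLF.
    by exists x => //; exists (cantor_add x z); last by rewrite cantor_addK.
  have [s [m [S0 SA]]] := positive_cylinder_missing cF cA T0 TA.
  by exists (pickle (s, m)) => //; rewrite pickleK.
case: (unpickle k) => [[s m]|]; last first.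
  exists 0%N => n _; rewrite (_ : prefixes _ _ = finset.set0) ?cards0//.
  by apply/finset.setP => t; rewrite !inE; apply/asboolP => -[].
have [S0|S0] := pselect (mu (S s) = 0%E).
  exists 0%N => n _; rewrite (_ : prefixes _ _ = finset.set0) ?cards0//.
  by apply/finset.setP => t; rewrite !inE; apply/asboolP => -[? []].
by apply: (@prefixes_small R d (Z (s, m)) (S s) m dS S0) => x [_]; exact.
Qed.

(** Continuity from above: the remainders decrease to the empty set. *)
Lemma haar_truncate (F : (set cantor_space)^nat) (e : R) :
  (forall i, cylinder (F i)) -> 0 < e -> exists a0, forall a, (a0 <= a)%N ->
    (mu (\bigcup_i F i `\` \bigcup_(i < a) F i) <= e%:E)%E.
Proof.
move=> cF e0; pose D a : set (g_sigma_algebraType (@measurable _ cylinder_type)) :=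
  \bigcup_i F i `\` \bigcup_(i < a) F i.
have mF i := cylinder_measurable (cF i).
have mD a : measurable (D a).
  by apply: measurableD; [exact: bigcupT_measurable|exact: bigcup_measurable].
have D0 : \bigcap_a D a = set0.
  apply/seteqP; split=> // z Dz; have [[i _ Fz] _] := Dz 0%N I.
  by have [_] := Dz i.+1 I; apply; exists i => //=.
have := @nonincreasing_cvg_mu _ _ R (haar R) D _ mD _ _.
rewrite D0 measure0 => cvgD.
have {}cvgD : (haar R \o D) x @[x --> \oo] --> 0%E.
  apply: cvgD => //.
  - apply: (@le_lt_trans _ _ (mu setT)); first exact: haar_le.
    by rewrite [mu setT]haar_setT ltry.
  - move=> a c ac; apply/subsetPset => z [Fz nFz]; split=> // -[i ia Fi].
    by apply: nFz; exists i => //=; exact: leq_trans ac.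
have /cvgD[a0 _ a0P] : nbhs (0%E : \bar R) [set x : \bar R | (x < e%:E)%E].
  by apply: open_nbhs_nbhs; split; [exact: open_ereal_lt_ereal|rewrite /= lte_fin].
by exists a0 => a /a0P/ltW.
Qed.

(** Each cover of [N] is truncated to a cylinder at every stage. [H n] joins the truncated cover [n]
    to what stage [n.+1] adds to the earlier covers. A point of [N] enters every cover [m] at some
    stage, hence lies in some [H n] with [n >= m]. *)
Lemma null_limsup N (e : nat -> R) : null_ideal R N -> (forall n, 0 < e n) ->
  exists H : (set cantor_space)^nat,
    [/\ forall n, cylinder (H n), forall n, (mu (H n) <= (e n)%:E)%E
      & N `<=` lim_sup_set H].
Proof.
move=> N0 e0.
have e2 n : 0 < e n / 2 by rewrite divr_gt0.
have cov n := null_cover N0 (e2 n).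
pose F n := projT1 (cid (cov n)).
have cF n : forall i, cylinder (F n i) by have [] := projT2 (cid (cov n)).
have NF n : N `<=` \bigcup_i F n i by have [] := projT2 (cid (cov n)).
have Fe n : (mu (\bigcup_i F n i) <= (e n / 2)%:E)%E by have [] := projT2 (cid (cov n)).
pose V n a := \bigcup_(i < a) F n i.
have cV n a : cylinder (V n a).
  rewrite /V bigcup_mkord; elim/big_ind: _ => // [|*]; first exact: cylinder0.
  exact: cylinderU.
(* At most [n] remainders share [e n / 2]; dividing by [n.+1] also covers [n = 0]. *)
have eta0 n : 0 < e n / 2 / n.+1%:R by rewrite divr_gt0.
have trunc n k := haar_truncate (cF k) (eta0 n).
pose q n k := projT1 (cid (trunc n k)).
have qP n k a : (q n k <= a)%N ->
    (mu (\bigcup_i F k i `\` V k a) <= (e n / 2 / n.+1%:R)%:E)%E.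
  exact: (projT2 (cid (trunc n k))).
(* The summand [n] makes the truncations exhaust each cover; the maximum keeps the remainders of the
   covers [k < n] small. *)
pose a n := (n + \max_(k < n) q n k)%N.
have aq n k : (k < n)%N -> (q n k <= a n)%N.
  move=> kn; apply: leq_trans (leq_addl _ _).
  exact: (leq_bigmax (Ordinal kn)).
exists (fun n => V n (a n.+1) `|` \big[setU/set0]_(k < n) (V k (a n.+1) `\` V k (a n))).
split=> [n|n|x Nx m _].
- apply: cylinderU => //; elim/big_ind: _ => // [||k _]; first exact: cylinder0.
    exact: cylinderU.
  by apply: cylinderI => //; exact: cylinderC.
- apply: le_trans (haarU_le _ _ _) _.
  rewrite [leRHS](_ : _ = (e n / 2)%:E + (e n / 2)%:E)%E; last first.
    by rewrite -EFinD; congr (_%:E); field.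
  apply: leeD.
    by apply: le_trans (Fe n); apply: haar_le => x [i _ Fx]; exists i.
  apply: (@le_trans _ _ (\sum_(k < n) mu (V k (a n.+1) `\` V k (a n)))%E).
    apply: haar_fin_cover => x; rewrite -(bigcup_mkord n (fun k => V k (a n.+1) `\` V k (a n))).
    by move=> [k kn Vx]; exists (Ordinal kn).
  apply: (@le_trans _ _ (\sum_(k < n) (e n / 2 / n.+1%:R)%:E)%E).
    apply: lee_sum => k _; apply: le_trans (qP n k (a n) (aq _ _ (ltn_ord k))).
    by apply: haar_le => x [[i _ Fx] nVx]; split=> //; exists i.
  rewrite sumEFin lee_fin sumr_const card_ord.
  rewrite -[_ *+ n]mulr_natr -(mulrA (e n / 2)) (ger_pMr _ (e2 n)).
  by rewrite ler_pdivrMl ?ltr0Sn// mulr1 ler_nat.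
- have [i _ Fx] := NF m x Nx.
  have Vi : exists n, (m < n)%N && `[< V m (a n) x >].
    exists (maxn m i).+1; rewrite ltnS leq_maxl; apply/asboolP; exists i => //=.
    by rewrite /a ltn_addr// ltnS leq_maxr.
  case: (ex_minnP Vi) => -[//|n] /andP[mn /asboolP Vn] nmin.
  exists n; first by [].
  (* If [m = n] the point is in the truncated cover itself; if [m < n], minimality puts it among the
     newly added points. *)
  move: mn; rewrite leq_eqVlt => /predU1P[[mn]|mn]; first by left; rewrite -{1}mn.
  right; rewrite -(bigcup_mkord n (fun k => V k (a n.+1) `\` V k (a n))); exists m => //; split=> // Vx.
  have /nmin : (m < n)%N && `[< V m (a n) x >] by rewrite -ltnS mn; apply/asboolP.
  by rewrite ltnn.
Qed.

End null_additive_prefixes.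

(** * Continuous images *)

(** Uniform continuity: [m] is the largest local modulus in a finite subcover. *)
Lemma continuous_modulus (f : cantor_space -> cantor_space) n : continuous f ->
  exists m, forall x y, cyl x m y -> cyl (f x) n (f y).
Proof.
move=> cf.
have loc (x : cantor_space) : exists m, cyl x m `<=` f @^-1` cyl (f x) n.
  apply: cantor_nbhs; apply: cf; apply: open_nbhs_nbhs; split=> //.
  by apply: determined_open; exact: determined_cyl.
have [m mP] := choice loc.
have := cantor_space_compact; rewrite compact_cover.
move=> /(_ cantor_space setT (fun x => cyl x (m x))) [x _||D _ cD].
- by apply: determined_open; exact: determined_cyl.
- by move=> x _; exists x.
- exists (\max_(x <- finmap.enum_fset D) m x) => x y xy.
  have [z Dz zx] := cD x I.
  have mz : (m z <= \max_(x <- finmap.enum_fset D) m x)%N.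
    exact: (@leq_bigmax_seq _ (finmap.enum_fset D) xpredT m).
  have fzx := mP z x zx; have fzy : cyl (f z) n (f y).
    by apply: (mP z); rewrite (cyl_agree zx); exact: (cyl_sub mz).
  by rewrite -(cyl_agree fzx).
Qed.

Theorem corollary9p3 (R : realType) (X : set cantor_space)
    (f : cantor_space -> cantor_space) :
  continuous f -> null_additive R X -> null_additive R (f @` X).
Proof.
move=> cf addX N N0.
(* At most [2^n] translates of measure [4^-n] have total measure at most [2^-n]. *)
have e0 n : 0 < 2 ^- n * 2 ^- n :> R by rewrite mulr_gt0// invr_gt0 exprn_gt0.
have [H [cH He NH]] := null_limsup N0 e0.
have [h hH] := choice cH.
have [b bP] := choice (fun n => continuous_modulus (h n) cf).
have [d [Y [bd XY Ysmall]]] := null_additive_prefixes b addX.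
(* Since [b n <= d n], replacing [x] by the zero extension of its prefix [t] keeps the first [h n]
   coordinates of [f x], all that [H n] sees. *)
pose t_add n (t : (d n).-tuple bool) := cantor_add (f (prefix_point t)) @^-1` H n.
pose M k n := \big[setU/set0]_(t in prefixes (d n) (Y k)) t_add n t.
suff Mnull k : null_ideal R (lim_sup_set (M k)).
  apply: (negligibleS _ (negligible_bigcup Mnull)).
  move=> _ [_ [x Xx <-] [y Ny <-]]; have [k _ Yx] := XY x Xx.
  exists k => // m _; have [n mn Hy] := NH y Ny m I; exists n => //.
  have tY : prefix (d n) x \in prefixes (d n) (Y k) by rewrite inE; apply/asboolP; exists x.
  rewrite /M (bigD1 _ tY)/=; left; apply: (hH n) Hy => i ih.
  have fx : cyl (f (prefix_point (prefix (d n) x))) (h n) (f x).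
    apply: bP; apply: (cyl_sub (bd n)) => j jd.
    by rewrite /prefix_point nth_prefix.
  by rewrite /cantor_add fx// addKb.
have [n0 n0P] := Ysmall k.
have Mc n : cylinder (M k n).
  rewrite /M; elim/big_ind: _ => [||t _]; [exact: cylinder0|exact: cylinderU|].
  by exists (h n) => y z yz; apply: hH => i ih; rewrite /cantor_add yz.
(* The prefix count is bounded only from [n0] on; emptying the earlier sets does not change the
   limsup. *)
pose M' n := if (n0 <= n)%N then M k n else set0.
apply: (@negligibleS _ _ _ (haar R) (lim_sup_set M')).
  move=> x Mx m _; have [n /= mn Mn] := Mx (maxn m n0) I.
  rewrite geq_max in mn; case/andP: mn => mn n0n.
  by exists n => //; rewrite /M' n0n.
apply: limsup_null => n; rewrite /M'; case: ifPn => // n0n; first exact: cylinder0; last first.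
  by rewrite [haar R _]measure0 lee_fin invr_ge0 exprn_ge0.
apply: (@le_trans _ _ (\sum_(t in prefixes (d n) (Y k)) haar R (t_add n t))%E).
  apply: haar_fin_cover => x; rewrite /M; elim/big_rec: _ => // t A tY IH [tx|/IH//].
  by exists t.
apply: (@le_trans _ _ (\sum_(t in prefixes (d n) (Y k)) (2 ^- n * 2 ^- n : R)%:E)%E).
  by apply: lee_sum => t _; rewrite /t_add -cantor_add_preimage haar_translate.
rewrite sumEFin lee_fin sumr_const -[_ *+ _]mulr_natl mulrA.
rewrite ler_piMl ?invr_ge0 ?exprn_ge0//.
by rewrite ler_pdivrMr ?exprn_gt0// mul1r -natrX ler_nat n0P.
Qed.
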